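(* If $e:[\forall\underline{x}.]\ \Rightarrow B$ is derivable given axioms $\Phi$, then $e$ is beta-normalizable to a first-order proof term.
   Context: First-order terms $t ::= x \mid f(t_1,\dots,t_n)$; atomic formulas $P(t_1,\dots,t_n)$; Horn formulas $F ::= [\forall \underline{x}].\ A_1,\dots,A_n \Rightarrow A$ ($n\ge0$; for $n=0$ written $\Rightarrow A$), where $\forall\underline{x}.F$ quantifies all free term variables of $F$ and $[\forall\underline{x}].F$ means $F$ or $\forall\underline{x}.F$. Proof terms $p,e ::= \kappa \mid a \mid \lambda a.e \mid e\ e'$ ($\kappa$ proof-term constants, $a$ proof-term variables); beta-reduction is the congruence closure of $(\lambda a.p)p'\to_\beta[p'/a]p$. A proof term is first-order if it is built from proof-term variables and constants by application only. A logic program $\Phi$ is a list of closed Horn formulas labelled by distinct proof-term constants. Typing $e:F$ given $\Phi$ is generated by: (axiom) $\kappa:\forall\underline{x}.F$ if $(\kappa:\forall\underline{x}.F)\in\Phi$; (gen) from $e:F$ infer $e:\forall\underline{x}.F$; (inst) from $e:\forall\underline{x}.F$ infer $e:[\underline{t}/\underline{x}]F$; (cut) from $e_1:\underline{A}\Rightarrow D$ and $e_2:\underline{B},D\Rightarrow C$ infer $\lambda\underline{a}.\lambda\underline{b}.(e_2\ \underline{b})\ (e_1\ \underline{a}) : \underline{A},\underline{B}\Rightarrow C$, with $\underline{a},\underline{b}$ fresh proof-term variable lists of the lengths of $\underline{A},\underline{B}$. *)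

(* Defs.v *)
From Stdlib Require Import List PeanoNat Relations.
Import ListNotations.

Set Implicit Arguments.

(** First-order terms and Horn formulas over function symbols [Fn] and
    predicate symbols [Pr]; term variables are natural numbers. *)

Inductive term (Fn : Type) : Type :=
| TVar (x : nat)
| TFun (f : Fn) (ts : list (term Fn)).
Arguments TVar {Fn} x.

Record atom (Fn Pr : Type) : Type := Atom {
  pred_sym : Pr;
  args : list (term Fn)
}.

Record clause (Fn Pr : Type) : Type := Clause {
  body : list (atom Fn Pr);
  head : atom Fn Pr
}.

(** As a quantifier always binds all the free variables of the formula under
    it, [All c] carries no list of bound names. *)
Inductive formula (Fn Pr : Type) : Type :=
| Open (c : clause Fn Pr)
| All (c : clause Fn Pr).

Fixpoint term_fv (Fn : Type) (t : term Fn) : list nat :=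
  match t with
  | TVar x => [x]
  | TFun _ ts => flat_map (@term_fv Fn) ts
  end.

Definition atom_fv (Fn Pr : Type) (A : atom Fn Pr) : list nat :=
  flat_map (@term_fv Fn) (args A).

Definition clause_fv (Fn Pr : Type) (c : clause Fn Pr) : list nat :=
  flat_map (@atom_fv Fn Pr) (body c) ++ atom_fv (head c).

Definition formula_fv (Fn Pr : Type) (F : formula Fn Pr) : list nat :=
  match F with
  | Open c => clause_fv c
  | All _ => []
  end.

Definition closed (Fn Pr : Type) (F : formula Fn Pr) : Prop :=
  formula_fv F = [].

Fixpoint term_subst (Fn : Type) (s : nat -> term Fn) (t : term Fn) : term Fn :=
  match t with
  | TVar x => s x
  | TFun f ts => TFun f (map (term_subst s) ts)
  end.

Definition atom_subst (Fn Pr : Type) (s : nat -> term Fn) (A : atom Fn Pr)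
  : atom Fn Pr :=
  Atom (pred_sym A) (map (term_subst s) (args A)).

Definition clause_subst (Fn Pr : Type) (s : nat -> term Fn) (c : clause Fn Pr)
  : clause Fn Pr :=
  Clause (map (atom_subst s) (body c)) (atom_subst s (head c)).

(** Proof terms over constants [K], up to alpha-equivalence: proof-term
    variables are de Bruijn indices, an index pointing beyond the enclosing
    binders being a free variable. *)

Inductive proof (K : Type) : Type :=
| PCon (k : K)
| PVar (a : nat)
| PLam (e : proof K)
| PApp (e1 e2 : proof K).
Arguments PVar {K} a.

Definition up_ren (r : nat -> nat) (a : nat) : nat :=
  match a with
  | 0 => 0
  | S a' => S (r a')
  end.

Fixpoint rename (K : Type) (r : nat -> nat) (e : proof K) : proof K :=
  match e with
  | PCon k => PCon k
  | PVar a => PVar (r a)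
  | PLam e1 => PLam (rename (up_ren r) e1)
  | PApp e1 e2 => PApp (rename r e1) (rename r e2)
  end.

Definition up (K : Type) (s : nat -> proof K) (a : nat) : proof K :=
  match a with
  | 0 => PVar 0
  | S a' => rename S (s a')
  end.

Fixpoint subst (K : Type) (s : nat -> proof K) (e : proof K) : proof K :=
  match e with
  | PCon k => PCon k
  | PVar a => s a
  | PLam e1 => PLam (subst (up s) e1)
  | PApp e1 e2 => PApp (subst s e1) (subst s e2)
  end.

(** [subst0 p' p] replaces index 0 by [p'] and lowers the other free indices
    of [p], whose outermost binder disappears. *)
Definition subst0 (K : Type) (p' p : proof K) : proof K :=
  subst (fun a => match a with 0 => p' | S a' => PVar a' end) p.

Inductive beta (K : Type) : proof K -> proof K -> Prop :=
| beta_redex p p' : beta (PApp (PLam p) p') (subst0 p' p)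
| beta_lam p q : beta p q -> beta (PLam p) (PLam q)
| beta_app_l p q r : beta p q -> beta (PApp p r) (PApp q r)
| beta_app_r p q r : beta p q -> beta (PApp r p) (PApp r q).

Definition beta_normal (K : Type) (p : proof K) : Prop :=
  forall q, ~ beta p q.

Definition beta_normalizes_to (K : Type) (e p : proof K) : Prop :=
  clos_refl_trans (proof K) (@beta K) e p /\ beta_normal p.

Inductive first_order (K : Type) : proof K -> Prop :=
| fo_con k : first_order (PCon k)
| fo_var a : first_order (PVar a)
| fo_app p q : first_order p -> first_order q -> first_order (PApp p q).

Definition lams (K : Type) (n : nat) (e : proof K) : proof K :=
  Nat.iter n (@PLam K) e.

Definition apps (K : Type) (e : proof K) (es : list (proof K)) : proof K :=
  fold_left (@PApp K) es e.

(** [lambda a_1 ... a_n. lambda b_1 ... b_m. (e2 b_1 ... b_m) (e1 a_1 ... a_n)].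
    Under the [n + m] binders, [b_m, ..., b_1] have the indices
    [0, ..., m - 1] and [a_n, ..., a_1] the indices [m, ..., m + n - 1];
    freshness of the binders is the shift of [e1] and [e2] by [n + m]. *)
Definition cut_term (K : Type) (n m : nat) (e1 e2 : proof K) : proof K :=
  let shift := rename (Nat.add (n + m)) in
  let a := map PVar (rev (seq m n)) in
  let b := map PVar (rev (seq 0 m)) in
  lams n (lams m (PApp (apps (shift e2) b) (apps (shift e1) a))).

Definition logic_program (Fn Pr K : Type) (Phi : list (K * formula Fn Pr))
  : Prop :=
  NoDup (map fst Phi) /\ (forall k F, In (k, F) Phi -> closed F).

(** [ty_axiom] is not restricted to formulas of the form [All c]: a clause
    without variables is closed, with or without its empty quantifier. *)
Inductive typing (Fn Pr K : Type) (Phi : list (K * formula Fn Pr))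
  : proof K -> formula Fn Pr -> Prop :=
| ty_axiom k F :
    In (k, F) Phi -> typing Phi (PCon k) F
| ty_gen e c :
    typing Phi e (Open c) -> typing Phi e (All c)
| ty_inst e c (s : nat -> term Fn) :
    typing Phi e (All c) -> typing Phi e (Open (clause_subst s c))
| ty_cut e1 e2 As Bs D C :
    typing Phi e1 (Open (Clause As D)) ->
    typing Phi e2 (Open (Clause (Bs ++ [D]) C)) ->
    typing Phi (cut_term (length As) (length Bs) e1 e2)
      (Open (Clause (As ++ Bs) C)).

(* Main.v *)
(** Reducibility argument. A derivable [e] with [n] premises is closed, and
    applied to any [n] first-order proof terms it reduces to a first-order one.
    For a cut, the redexes on the bound variables fire first; reducibility of
    [e1] makes [e1 a] first-order, so that it may be the last argument of [e2].
    For [n = 0] this is the theorem, as first-order proof terms have no redex. *)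

Require Import Defs.
From Stdlib Require Import List.
Import ListNotations.
From Stdlib Require Import Arith Lia Relations.

Section ProofTerms.

Variable K : Type.
Implicit Types (p q e : proof K) (s t : nat -> proof K) (es l : list (proof K)).

Notation "p ->* q" := (clos_refl_trans (proof K) (@beta K) p q) (at level 70).

Lemma subst_ext p s t : (forall a, s a = t a) -> subst s p = subst t p.
Proof.
  revert s t; induction p as [k|a|p IH|p1 IH1 p2 IH2]; intros s t H; simpl;
    try f_equal; auto.
  apply IH; intros [|a]; simpl; rewrite ?H; reflexivity.
Qed.

Lemma subst_id p : subst PVar p = p.
Proof.
  induction p as [k|a|p IH|p1 IH1 p2 IH2]; simpl; try f_equal; auto.
  rewrite <- IH at 2; apply subst_ext; intros [|a]; reflexivity.
Qed.

Lemma rename_as_subst r p : rename r p = subst (fun a => PVar (r a)) p.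
Proof.
  revert r; induction p as [k|a|p IH|p1 IH1 p2 IH2]; intros r; simpl;
    try f_equal; auto.
  rewrite IH; apply subst_ext; intros [|a]; reflexivity.
Qed.

Lemma subst_rename s r p : subst s (rename r p) = subst (fun a => s (r a)) p.
Proof.
  revert s r; induction p as [k|a|p IH|p1 IH1 p2 IH2]; intros s r; simpl;
    try f_equal; auto.
  rewrite IH; apply subst_ext; intros [|a]; reflexivity.
Qed.

Lemma rename_rename r r' p : rename r (rename r' p) = rename (fun a => r (r' a)) p.
Proof.
  rewrite rename_as_subst, subst_rename, <- rename_as_subst; reflexivity.
Qed.

Lemma rename_subst r s p : rename r (subst s p) = subst (fun a => rename r (s a)) p.
Proof.
  revert r s; induction p as [k|a|p IH|p1 IH1 p2 IH2]; intros r s; simpl;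
    try f_equal; auto.
  rewrite IH; apply subst_ext; intros [|a]; simpl; [reflexivity|].
  rewrite !rename_rename; reflexivity.
Qed.

(** Under a binder [up] renames by [S], so composing two substitutions there rests on both mixed
    laws, [subst_rename] and [rename_subst]. *)
Lemma subst_subst s t p : subst s (subst t p) = subst (fun a => subst s (t a)) p.
Proof.
  revert s t; induction p as [k|a|p IH|p1 IH1 p2 IH2]; intros s t; simpl;
    try f_equal; auto.
  rewrite IH; apply subst_ext; intros [|a]; simpl; [reflexivity|].
  rewrite subst_rename, rename_subst; reflexivity.
Qed.

Lemma lams_add n m p : lams n (lams m p) = lams (n + m) p.
Proof. unfold lams; rewrite Nat.iter_add; reflexivity. Qed.

Lemma subst_lams s k p : subst s (lams k p) = lams k (subst (Nat.iter k (@up K) s) p).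
Proof.
  revert s; induction k as [|k IH]; intros s; [reflexivity|].
  rewrite Nat.iter_succ_r; simpl; f_equal; apply IH.
Qed.

Lemma iter_up_lt s k a : a < k -> Nat.iter k (@up K) s a = PVar a.
Proof.
  revert a; induction k as [|k IH]; intros [|a] H; simpl; try lia; auto.
  rewrite IH by lia; reflexivity.
Qed.

Lemma subst_apps s e es : subst s (apps e es) = apps (subst s e) (map (subst s) es).
Proof. revert e; induction es as [|x es IH]; intros e; simpl; auto. Qed.

Lemma apps_snoc e es x : apps e (es ++ [x]) = PApp (apps e es) x.
Proof. unfold apps; rewrite fold_left_app; reflexivity. Qed.

Lemma beta_star_app p p' q q' : p ->* p' -> q ->* q' -> PApp p q ->* PApp p' q'.
Proof.
  intros Hp Hq; apply rt_trans with (PApp p' q).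
  - induction Hp; eauto using rt_refl, rt_trans, rt_step, beta_app_l.
  - induction Hq; eauto using rt_refl, rt_trans, rt_step, beta_app_r.
Qed.

(** The simultaneous substitution that fires a block of [length l] redexes: indices beyond the block
    drop by its length, as in [subst0] for one binder. *)
Fixpoint env (l : list (proof K)) (a : nat) : proof K :=
  match l, a with
  | [], _ => PVar a
  | x :: _, 0 => x
  | _ :: l', S a' => env l' a'
  end.

(* [env] lists the arguments innermost binder first, hence the [rev]. *)
Lemma apps_lams_beta l p : apps (lams (length l) p) (rev l) ->* subst (env l) p.
Proof.
  revert p; induction l as [|x l IH]; intros p; cbn [length rev].
  - rewrite (@subst_ext p (env []) PVar), subst_id by (intros [|a]; reflexivity).
    apply rt_refl.
  - rewrite apps_snoc.
    (* The innermost binder is split off, so that the induction hypothesis applies to [PLam p] and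
       leaves a single redex with argument [x]. *)
    change (S (length l)) with (1 + length l); rewrite Nat.add_comm, <- lams_add.
    eapply rt_trans; [apply beta_star_app; [apply IH | apply rt_refl]|].
    simpl; eapply rt_trans; [apply rt_step, beta_redex|].
    unfold subst0; rewrite subst_subst, (@subst_ext p _ (env (x :: l))).
    + apply rt_refl.
    + intros [|a]; simpl; [reflexivity|].
      rewrite subst_rename; apply subst_id.
Qed.

Lemma map_env_seq l0 l l1 :
  map (env (l0 ++ l ++ l1)) (seq (length l0) (length l)) = l.
Proof.
  revert l0; induction l as [|x l IH]; intros l0; simpl; [reflexivity|].
  f_equal.
  - induction l0; auto.
  - specialize (IH (l0 ++ [x])).
    rewrite <- app_assoc, length_app, Nat.add_comm in IH; exact IH.
Qed.

Lemma first_order_apps e es :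
  first_order e -> Forall (@first_order K) es -> first_order (apps e es).
Proof.
  intros He Hes; revert e He; induction Hes; intros e He; simpl; auto using fo_app.
Qed.

Lemma first_order_normal p : first_order p -> beta_normal p.
Proof.
  intros Hp q Hq; induction Hq; inversion Hp; subst; auto.
  match goal with H : first_order (PLam _) |- _ => inversion H end.
Qed.

(** Closedness, in the form in which it is used: substitutions and the shifts in [cut_term] leave
    the term alone. *)
Definition invariant e : Prop := forall s, subst s e = e.

Definition reducible (n : nat) e : Prop :=
  invariant e /\
  forall es, length es = n -> Forall (@first_order K) es ->
  exists p, first_order p /\ apps e es ->* p.

Lemma rename_invariant r e : invariant e -> rename r e = e.
Proof. intros He; rewrite rename_as_subst; apply He. Qed.

Lemma subst_vars s (xs : list nat) : map (subst s) (map PVar xs) = map s xs.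
Proof. rewrite map_map; reflexivity. Qed.

(** The listed arguments are indices below [n + m], all bound by the block, so a substitution lifted
    through it fixes them. *)
Lemma cut_term_invariant n m e1 e2 :
  invariant e1 -> invariant e2 -> invariant (cut_term n m e1 e2).
Proof.
  intros H1 H2 s; unfold cut_term; rewrite !rename_invariant by assumption.
  rewrite lams_add, subst_lams; simpl; rewrite !subst_apps, H1, H2, !subst_vars.
  do 3 f_equal; apply map_ext_in; intros a Ha;
    rewrite <- in_rev, in_seq in Ha; apply iter_up_lt; lia.
Qed.

Lemma cut_term_beta e1 e2 es1 es2 :
  invariant e1 -> invariant e2 ->
  apps (cut_term (length es1) (length es2) e1 e2) (es1 ++ es2)
    ->* PApp (apps e2 es2) (apps e1 es1).
Proof.
  intros H1 H2; unfold cut_term; rewrite !rename_invariant by assumption.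
  (* Brings the goal to the form of [apps_lams_beta] for the list [rev (es1 ++ es2)]. *)
  rewrite lams_add, <- length_app, <- length_rev, <- (rev_involutive (es1 ++ es2)).
  rewrite (rev_involutive (rev _)).
  eapply rt_trans; [apply apps_lams_beta|].
  rewrite rev_app_distr; simpl; rewrite !subst_apps, H1, H2, !subst_vars, !map_rev.
  (* Innermost first, the environment is [rev es2 ++ rev es1]: indices from 0 read off [es2], those
     from [length es2] read off [es1]. *)
  pose proof (map_env_seq [] (rev es2) (rev es1)) as E2.
  pose proof (map_env_seq (rev es2) (rev es1) []) as E1.
  rewrite app_nil_r, !length_rev in E1; simpl in E2; rewrite length_rev in E2.
  rewrite E1, E2, !rev_involutive; apply rt_refl.
Qed.

(** An axiom may have any number of premises, so [n] is arbitrary; the application is first-order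
    already and takes no step. *)
Lemma reducible_con k n : reducible n (PCon k).
Proof.
  split; [intros s; reflexivity|].
  intros es _ Hes; exists (apps (PCon k) es); split; [|apply rt_refl].
  apply first_order_apps; [constructor | assumption].
Qed.

Lemma reducible_cut n m e1 e2 :
  reducible n e1 -> reducible (S m) e2 -> reducible (n + m) (cut_term n m e1 e2).
Proof.
  intros [I1 R1] [I2 R2]; split; [apply cut_term_invariant; assumption|].
  intros es Hlen Hes.
  rewrite <- (firstn_skipn n es) in Hes |- *; apply Forall_app in Hes as [Hes1 Hes2].
  assert (L1 : length (firstn n es) = n) by (rewrite length_firstn; lia).
  assert (L2 : length (skipn n es) = m) by (rewrite length_skipn; lia).
  destruct (R1 _ L1 Hes1) as (p1 & F1 & S1).
  (* The cut atom is the last premise of the second clause, so [p1] follows the other arguments. *)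
  destruct (R2 (skipn n es ++ [p1])) as (p2 & F2 & S2).
  { rewrite length_app; simpl; lia. }
  { apply Forall_app; auto. }
  exists p2; split; [assumption|].
  rewrite <- L1 at 1; rewrite <- L2 at 1.
  eapply rt_trans; [apply cut_term_beta; assumption|].
  eapply rt_trans; [|exact S2].
  rewrite apps_snoc; apply beta_star_app; [apply rt_refl | exact S1].
Qed.

End ProofTerms.

Arguments reducible {K} n e.

Definition formula_clause {Fn Pr : Type} (F : formula Fn Pr) : clause Fn Pr :=
  match F with Open c | All c => c end.

(** Reducibility sees only the number of premises, which [ty_gen] and [ty_inst] preserve. *)
Lemma typing_reducible (Fn Pr K : Type) (Phi : list (K * formula Fn Pr))
  (e : proof K) (F : formula Fn Pr) :
  typing Phi e F -> reducible (length (body (formula_clause F))) e.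
Proof.
  induction 1 as [k F _ | e c _ IH | e c s _ IH | e1 e2 As Bs D C _ IH1 _ IH2];
    simpl in *.
  - apply reducible_con.
  - exact IH.
  - rewrite length_map; exact IH.
  - rewrite length_app in *; apply reducible_cut; [exact IH1|].
    simpl in IH2; rewrite Nat.add_1_r in IH2; exact IH2.
Qed.

Theorem theorem3 (Fn Pr K : Type) (Phi : list (K * formula Fn Pr))
  (hPhi : logic_program Phi) (e : proof K) (B : atom Fn Pr)
  (he : typing Phi e (Open (Clause [] B)) \/ typing Phi e (All (Clause [] B))) :
  exists p : proof K, beta_normalizes_to e p /\ first_order p.
Proof.
  assert (R : reducible 0 e).
  { destruct he as [he|he]; exact (typing_reducible _ _ _ _ _ _ he). }
  destruct R as [_ R]; destruct (R [] eq_refl (Forall_nil _)) as (p & Fp & Sp).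
  exists p; split; [split|]; auto using first_order_normal.
Qed.
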